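(* Let $F$ be a scalar group, let $V$ be a near-vector space over $F$, let $v\in V\setminus\{0\}$ and let $\alpha,\beta\in F$ be such that $\alpha\neq\beta$. Then $\operatorname{Span}(v)=\operatorname{Span}(\alpha\cdot v-\beta\cdot v)$. Moreover, $\dim(v)=\dim(\alpha\cdot v-\beta\cdot v)$.
   Context: A scalar group is a tuple $F=(F,\cdot,1,0,-1)$ where $(F,\cdot,1)$ is a monoid, $0,-1\in F$, $0\cdot\alpha=0=\alpha\cdot 0$ for all $\alpha\in F$, $\{1,-1\}$ is the solution set of the equation $x^2=1$ in $F$, and $(F\setminus\{0\},\cdot,1)$ is a group. Write $-\alpha := (-1)\cdot\alpha$. An $F$-space is an abelian group $(V,+)$ with a map $F\times V\to V$, $(\alpha,v)\mapsto\alpha\cdot v$, such that for all $\alpha,\beta\in F$, $v,w\in V$: $\alpha\cdot(\beta\cdot v)=(\alpha\cdot\beta)\cdot v$, $1\cdot v=v$, $\alpha\cdot(v+w)=\alpha\cdot v+\alpha\cdot w$, $(-1)\cdot v=-v$, $0\cdot v=0$. The quasi-kernel of $V$ is $Q(V)=\{v\in V\mid \forall \alpha,\beta\in F\ \exists\gamma\in F:\ \alpha\cdot v+\beta\cdot v=\gamma\cdot v\}$. A near-vector space over $F$ is an $F$-space $V$ whose action is free (if $\alpha\cdot v=\beta\cdot v$ then $v=0$ or $\alpha=\beta$) and such that $Q(V)$ generates $V$ as an additive group. For $v\in V\setminus\{0\}$, $\dim(v)$ is the minimum number of distinct elements of $Q(V)$ such that $v$ is the sum of those elements; $\dim(0)=0$.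 $\operatorname{Span}(S)$ is the intersection of all nonempty subsets of $V$ that contain $S$ and are closed under addition and scalar multiplication; $\operatorname{Span}(v)=\operatorname{Span}(\{v\})$. *)

(* Defs.v *)
From HB Require Import structures.
From mathcomp Require Import all_boot ssralg.
From mathcomp Require Import boolp classical_sets.

Set Implicit Arguments.
Unset Strict Implicit.
Unset Printing Implicit Defensive.

Import GRing.Theory.

Local Open Scope classical_set_scope.
Local Open Scope ring_scope.

Declare Scope nearvect_scope.
Delimit Scope nearvect_scope with NV.
Local Open Scope nearvect_scope.

Reserved Notation "a *> v" (at level 40, v at level 40, right associativity).

(* The monoid law of [F] is the library's multiplicative one, written in %g.
   The last three axioms say that [F \ {0}] is a group under it: it contains 1,
   is closed under multiplication, and its elements have inverses in it. Note
   that [sgN1 = 1] is allowed. *)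
HB.mixin Record Monoid_isScalarGroup F of Monoid F := {
  sg0 : F;
  sgN1 : F;
  sg0M : forall a : F, (sg0 * a)%g = sg0;
  sgM0 : forall a : F, (a * sg0)%g = sg0;
  sg_sqr1 : forall a : F, (a ^+ 2)%g = 1%g <-> a = 1%g \/ a = sgN1;
  sg1_neq0 : 1%g <> sg0;
  sgM_neq0 : forall a b : F, a <> sg0 -> b <> sg0 -> (a * b)%g <> sg0;
  sgV : forall a : F, a <> sg0 ->
    exists b : F, [/\ b <> sg0, (a * b)%g = 1%g & (b * a)%g = 1%g]
}.

#[short(type="scalarGroupType")]
HB.structure Definition ScalarGroup :=
  { F of Monoid_isScalarGroup F & Monoid F }.

HB.mixin Record Zmodule_isFSpace (F : scalarGroupType) V of GRing.Zmodule V := {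
  fsact : F -> V -> V;
  fsactA : forall (a b : F) (v : V), fsact a (fsact b v) = fsact (a * b)%g v;
  fsact1 : forall v : V, fsact 1%g v = v;
  fsactDr : forall (a : F) (v w : V), fsact a (v + w) = fsact a v + fsact a w;
  fsactN1 : forall v : V, fsact sgN1 v = - v;
  fsact0 : forall v : V, fsact sg0 v = 0
}.

#[short(type="fSpaceType")]
HB.structure Definition FSpace (F : scalarGroupType) :=
  { V of Zmodule_isFSpace F V & GRing.Zmodule V }.

Notation "a *> v" := (fsact a v) : nearvect_scope.

Definition quasi_kernel (F : scalarGroupType) (V : fSpaceType F) : set V :=
  [set v | forall a b : F, exists c : F, a *> v + b *> v = c *> v].

Definition additive_subgroup (V : zmodType) (W : set V) : Prop :=
  [/\ W 0, forall v w, W v -> W w -> W (v + w) & forall v, W v -> W (- v)].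

HB.mixin Record FSpace_isNearVectorSpace (F : scalarGroupType) V
    of FSpace F V := {
  fsact_free : forall (a b : F) (v : V), a *> v = b *> v -> v = 0 \/ a = b;
  quasi_kernel_gen :
    smallest (@additive_subgroup V) (@quasi_kernel F V) = [set: V]
}.

#[short(type="nearVectorSpaceType")]
HB.structure Definition NearVectorSpace (F : scalarGroupType) :=
  { V of FSpace_isNearVectorSpace F V & FSpace F V }.

Section Span.
Variables (F : scalarGroupType) (V : fSpaceType F).

Definition is_subspace (W : set V) : Prop :=
  [/\ W !=set0, forall v w, W v -> W w -> W (v + w)
    & forall (a : F) v, W v -> W (a *> v)].

(* [smallest C S] is the intersection of all the [W] with [C W] that
   contain [S]. *)
Definition nvspan (S : set V) : set V := smallest is_subspace S.

End Span.

Section Dim.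
Variables (F : scalarGroupType) (V : fSpaceType F).

Definition sum_of_quasi (v : V) (n : nat) : Prop :=
  exists s : seq V, [/\ uniq s, size s = n,
    forall q, q \in s -> quasi_kernel q & v = \sum_(q <- s) q].

(* The default value 0 of [xget] is used only if [v] is not a sum of elements
   of the quasi-kernel; this never occurs in a near-vector space, see
   [sum_of_quasi_ex] and [nvdim_minimal]. *)
Definition nvdim (v : V) : nat :=
  if v == 0 then 0%N
  else xget 0%N [set n | sum_of_quasi v n /\
                         forall m, sum_of_quasi v m -> (n <= m)%N].

End Dim.

Section DimWellDefined.
Variables (F : scalarGroupType) (V : nearVectorSpaceType F).

Lemma quasi_kernel_act (a : F) (v : V) :
  quasi_kernel v -> quasi_kernel (a *> v).
Proof.
have [->|a0] := pselect (a = sg0).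
  by move=> _ b c; exists 1%g; rewrite !fsactA !sgM0 !fsact0 addr0.
move=> Qv b c; have [d vd] := Qv (b * a)%g (c * a)%g.
have [a' [_ _ a'a]] := sgV _ a0.
exists (d * a')%g; rewrite !fsactA vd; congr (_ *> _).
by rewrite -mulgA a'a mulg1.
Qed.

Lemma not_uniq_rem (T : eqType) (s : seq T) :
  ~~ uniq s -> exists q, q \in rem q s.
Proof.
elim: s => //= x s IHs; rewrite negb_and negbK => /orP[xs|/IHs[q qs]].
  by exists x; rewrite eqxx.
by exists q; case: eqP => _; [apply: mem_rem qs | rewrite inE qs orbT].
Qed.

Lemma sum_of_quasi_ex (v : V) : exists n, sum_of_quasi v n.
Proof.
pose W := [set v : V | exists s : seq V,
  (forall q, q \in s -> quasi_kernel q) /\ v = \sum_(q <- s) q].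
have Wgrp : additive_subgroup W.
  split; first by exists [::]; rewrite big_nil.
  - move=> x y [s [Qs ->]] [t [Qt ->]]; exists (s ++ t).
    by rewrite big_cat; split=> // q; rewrite mem_cat => /orP[/Qs|/Qt].
  move=> x [s [Qs ->]]; exists [seq - q | q <- s]; split.
    by move=> _ /mapP[q /Qs Qq ->]; rewrite -(@fsactN1 F); apply: quasi_kernel_act.
  by rewrite big_map sumrN.
have : smallest (@additive_subgroup V) (@quasi_kernel F V) v.
  by rewrite quasi_kernel_gen.
case/(_ W); first split=> // q Qq.
  by exists [:: q]; rewrite big_seq1; split=> // r; rewrite inE => /eqP->.
move=> s [Qs ->] {v}.
elim: {s}(size s) {-2}s (leqnn (size s)) Qs => [|n IHn] s.
  by rewrite leqn0 size_eq0 => /eqP-> _; exists 0%N, [::].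
move=> sn Qs; have [us|] := boolP (uniq s); first by exists (size s), s.
case/not_uniq_rem=> q qs'; have qs := mem_rem qs'.
have [c qc] := Qs _ qs 1%g 1%g; rewrite !fsact1 in qc.
have Qc : quasi_kernel (c *> q) by apply: quasi_kernel_act; apply: Qs.
rewrite (big_rem _ qs) (big_rem _ qs') /= addrA qc.
have [||m] := IHn (c *> q :: rem q (rem q s)); last by rewrite big_cons; exists m.
  have s_gt1 : (0 < size (rem q s))%N by case: (rem q s) qs'.
  by rewrite /= size_rem // prednK // size_rem // -ltnS prednK //; case: (s) qs.
move=> r; rewrite inE => /orP[/eqP->//|/mem_rem/mem_rem]; exact: Qs.
Qed.

Lemma nvdim_minimal (v : V) :
  sum_of_quasi v (nvdim v) /\ forall m, sum_of_quasi v m -> (nvdim v <= m)%N.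
Proof.
rewrite /nvdim; case: eqP => [->|_]; first by split=> //; exists [::]; rewrite big_nil.
case: xgetP => [n _ //|none]; exfalso.
have [n0 n0P] := sum_of_quasi_ex v.
have ex : exists n, `[< sum_of_quasi v n >] by exists n0; apply/asboolP.
case: (ex_minnP ex) => n /asboolP nP nmin; apply: (none n); split=> // m mP.
by apply/nmin/asboolP.
Qed.

End DimWellDefined.

(* Main.v *)
(* For every subspace [W], the action of [F] on [V / W] is still free: if
   [a v - b v] lies in [W] with [a <> b], and [v] is congruent to
   [q_1 + ... + q_n] with the [q_i] in the quasi-kernel, then [a q_1 - b q_1]
   is [c q_1] with [c] invertible unless [q_1 = 0], so [q_1] can be eliminated
   modulo [W]; repeating this gives [v \in W]. With [W] the span of
   [a v - b v], this yields the equality of spans. The dimensions agree since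
   the sums of multiples of fixed quasi-kernel elements form a subspace, so
   that [x \in Span(y)] implies [dim x <= dim y]. *)
Require Import Defs.
From mathcomp Require Import all_boot ssralg.
From mathcomp Require Import boolp classical_sets.

Local Open Scope classical_set_scope.
Local Open Scope ring_scope.
Local Open Scope nearvect_scope.

Import GRing.Theory.

Section FSpaceTheory.
Context {F : scalarGroupType} {V : fSpaceType F}.
Implicit Types (a b c : F) (v w q : V) (W : set V) (s : seq V).

Lemma fsactr0 a : a *> (0 : V) = 0.
Proof. by apply: (addIr (a *> 0)); rewrite -fsactDr !add0r. Qed.

Lemma fsactN a v : a *> (- v) = - (a *> v).
Proof. by apply: (addIr (a *> v)); rewrite -fsactDr !addNr fsactr0. Qed.

Lemma fsactBB a b v w :
  a *> (v - w) - b *> (v - w) = (a *> v - b *> v) - (a *> w - b *> w).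
Proof. by rewrite !fsactDr !fsactN opprD addrACA -opprD. Qed.

Lemma subspace0 {W} : is_subspace W -> W 0.
Proof. by case=> -[w Ww] _ WZ; rewrite -(fsact0 w); apply: WZ. Qed.

Lemma subspaceB {W} v w : is_subspace W -> W v -> W w -> W (v - w).
Proof. by case=> _ WD WZ Wv Ww; rewrite -fsactN1; apply/WD/WZ. Qed.

Lemma nvspan_subspace (S : set V) : is_subspace (nvspan S).
Proof.
split.
- by exists 0 => W [/subspace0 W0 _].
- move=> v w Sv Sw W WS; have [[_ WD _] _] := WS.
  exact: WD (Sv W WS) (Sw W WS).
- by move=> a v Sv W WS; have [[_ _ WZ] _] := WS; exact: WZ (Sv W WS).
Qed.

Lemma nvspan1_id v : nvspan [set v] v.
Proof. by move=> W [_]; apply. Qed.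

Lemma nvspan1_sub {W v} : is_subspace W -> W v -> nvspan [set v] `<=` W.
Proof. by move=> Wsub Wv; apply: smallest_sub => // _ ->. Qed.

(** The recursion exposes the multiple of the first entry, which is the summand eliminated in
    [quotient_free_lincomb]. *)
Fixpoint lincomb s : set V :=
  if s is q :: t then [set x | exists c y, lincomb t y /\ x = c *> q + y]
  else [set 0].

Lemma lincomb_sum s : lincomb s (\sum_(q <- s) q).
Proof.
elim: s => [|q s IHs]; rewrite /= ?big_nil // big_cons.
by exists 1%g, (\sum_(r <- s) r); rewrite fsact1.
Qed.

(** Closure under addition is where the quasi-kernel enters: [a *> q + b *> q] collapses to a single
    multiple of [q]. *)
Lemma lincomb_subspace {s} :
  (forall q, q \in s -> quasi_kernel q) -> is_subspace (lincomb s).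
Proof.
elim: s => [|q s IHs] Qs.
  split; first by exists 0.
    by move=> _ _ -> ->; rewrite /= addr0.
  by move=> a _ ->; rewrite /= fsactr0.
have [|s_neq0 sD sZ] := IHs; first by move=> r rs; apply: Qs; rewrite inE rs orbT.
split; first by exists (\sum_(r <- q :: s) r); apply: lincomb_sum.
  move=> _ _ [a [x [sx ->]]] [b [y [sy ->]]].
  have [c qc] := Qs q (mem_head _ _) a b.
  by exists c, (x + y); rewrite addrACA qc; split=> //; apply: sD.
move=> a _ [b [x [sx ->]]]; exists (a * b)%g, (a *> x).
by rewrite fsactDr fsactA; split=> //; apply: sZ.
Qed.

End FSpaceTheory.

Section NearVectorSpaceTheory.
Context {F : scalarGroupType} {V : nearVectorSpaceType F}.
Implicit Types (a b c : F) (v w q : V) (W : set V) (s : seq V).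

(** The coefficients are absorbed into the summands. The entries of [t] may coincide, so this does
    not yet bound [nvdim v]. *)
Lemma lincomb_sumE {s v} :
  (forall q, q \in s -> quasi_kernel q) -> lincomb s v ->
  exists t : seq V, [/\ size t = size s,
    forall q, q \in t -> quasi_kernel q & v = \sum_(q <- t) q].
Proof.
elim: s v => [|q s IHs] v Qs /=; first by move=> ->; exists [::]; rewrite big_nil.
move=> [c [y [sy ->]]].
have [|t [<- Qt ->]] := IHs y _ sy; first by move=> r rs; apply: Qs; rewrite inE rs orbT.
exists (c *> q :: t); rewrite big_cons; split=> // r.
rewrite inE => /orP[/eqP->|/Qt//]; apply: quasi_kernel_act; exact/Qs/mem_head.
Qed.

(* Two equal summands [q] can be merged into one, as [q + q] is a multiple
   of [q]. *)
Lemma sum_of_quasi_le {s} :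
  (forall q, q \in s -> quasi_kernel q) ->
  exists2 m, (m <= size s)%N & sum_of_quasi (\sum_(q <- s) q) m.
Proof.
have [n] := ubnP (size s); elim: n s => // n IHn s; rewrite ltnS => sn Qs.
have [us|] := boolP (uniq s); first by exists (size s) => //; exists s.
case/not_uniq_rem=> q qs'; have qs := mem_rem qs'.
have [c qc] := Qs _ qs 1%g 1%g; rewrite !fsact1 in qc.
rewrite (big_rem _ qs) (big_rem _ qs') /= addrA qc.
have szE : size s = (size (rem q (rem q s))).+2.
  by rewrite (perm_size (perm_to_rem qs)) /= (perm_size (perm_to_rem qs')).
rewrite szE in sn *.
have [//||m mt] := IHn (c *> q :: rem q (rem q s)).
  move=> r; rewrite inE => /orP[/eqP->|/mem_rem/mem_rem/Qs//].
  exact/quasi_kernel_act/Qs.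
by rewrite big_cons; exists m => //; apply: leqW.
Qed.

(** A shortest decomposition [s] of [w] gives a subspace [lincomb s] containing [w], hence [v];
    merging repeated summands of [v] only shortens the sum. *)
Lemma nvdim_span v w : nvspan [set w] v -> (nvdim v <= nvdim w)%N.
Proof.
have [[s [_ <- Qs wE]] _] := nvdim_minimal w.
move=> /(nvspan1_sub (lincomb_subspace Qs)) sv.
have [|t [<- Qt vE]] := lincomb_sumE Qs (sv _); first by rewrite wE; apply: lincomb_sum.
have [m mt] := sum_of_quasi_le Qt; rewrite -vE.
by move=> /(nvdim_minimal v).2 /leq_trans; apply.
Qed.

Lemma quasi_kernelB a b {q} :
  quasi_kernel q -> exists c, a *> q - b *> q = c *> q.
Proof.
by move=> /(_ a (sgN1 * b)%g) [c qc]; exists c; rewrite -qc -fsactA fsactN1.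
Qed.

Lemma quotient_free_lincomb {W a b v s} :
  is_subspace W -> a <> b -> W (a *> v - b *> v) ->
  (forall q, q \in s -> quasi_kernel q) ->
  (exists2 x, lincomb s x & W (v - x)) -> W v.
Proof.
move=> Wsub ab Wabv; have [_ WD WZ] := Wsub.
elim: s => [|q s IHs] Qs; first by case=> _ ->; rewrite subr0.
have Qs' r : r \in s -> quasi_kernel r by move=> rs; apply: Qs; rewrite inE rs orbT.
have sub := lincomb_subspace Qs'; have [_ sD sZ] := sub.
case=> _ [c [y [sy ->]]]; set p := c *> q => Wv; apply: IHs => //.
have Qp : quasi_kernel p by apply: quasi_kernel_act; apply/Qs/mem_head.
have [g pg] := quasi_kernelB a b Qp.
(* If [g] is zero, then [a *> p = b *> p], so [p = 0] by freeness and [y] itself is the witness. *)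
have [g0|/sgV[g' [_ _ g'g]]] := pselect (g = sg0).
  exists y => //; move: pg; rewrite g0 fsact0 => /subr0_eq/fsact_free[p0|//].
  by move: Wv; rewrite p0 add0r.
pose y' := a *> y - b *> y.
have sy' : lincomb s y' by apply: subspaceB => //; apply: sZ.
(* Modulo [W], [v] is [p + y] and [g *> p + y'] vanishes, so [p] is [- (g' *> y')]. *)
exists (y - g' *> y'); first by apply: subspaceB => //; apply: sZ.
have Wgp : W (g *> p + y').
  (* Both sides are [a *> (p + y) - b *> (p + y)], with [p + y] written on the right as
     [v - (v - (p + y))]. *)
  have -> : g *> p + y' =
      (a *> v - b *> v) - (a *> (v - (p + y)) - b *> (v - (p + y))).
    by rewrite -pg -fsactBB subKr !fsactDr opprD addrACA.
  by apply: subspaceB => //; apply: subspaceB => //; apply: WZ.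
have -> : v - (y - g' *> y') = (v - (p + y)) + g' *> (g *> p + y').
  rewrite (fsactDr g' (g *> p)) (fsactA g' g) g'g fsact1.
  by rewrite opprB [p + y]addrC opprD !addrA subrK addrAC.
by apply: WD => //; apply: WZ.
Qed.

Lemma quotient_free {W a b v} :
  is_subspace W -> a <> b -> W (a *> v - b *> v) -> W v.
Proof.
move=> Wsub ab Wabv; have [n [s [_ _ Qs vE]]] := sum_of_quasi_ex v.
apply: (quotient_free_lincomb Wsub ab Wabv Qs).
(* The elimination starts from [v] itself, congruent to [v] modulo any [W]. *)
by exists v; [rewrite vE; apply: lincomb_sum | rewrite subrr; apply: subspace0].
Qed.

End NearVectorSpaceTheory.

Theorem corollary3p15 (F : scalarGroupType) (V : nearVectorSpaceType F) (v : V)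
    (a b : F) (v0 : v <> 0) (ab : a <> b) :
  nvspan [set v] = nvspan [set a *> v - b *> v] /\
  nvdim v = nvdim (a *> v - b *> v).
Proof.
set w := a *> v - b *> v.
have vw : nvspan [set w] v.
  exact: quotient_free (nvspan_subspace _) ab (nvspan1_id w).
have wv : nvspan [set v] w.
  have sub := nvspan_subspace [set v]; have [_ _ sZ] := sub.
  exact: subspaceB sub (sZ a _ (nvspan1_id v)) (sZ b _ (nvspan1_id v)).
split; last by apply/eqP; rewrite eqn_leq !nvdim_span.
by apply/seteqP; split; apply: (nvspan1_sub (nvspan_subspace _)).
Qed.
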